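(* Let $(Q_i, \varphi_{ij}, I)$ be a projective system of compact Hausdorff topological quandles. Then the projective limit $Q= \varprojlim_{i \in I} Q_i$ exists. Moreover, if the connecting homomorphisms $\varphi_{ij}: Q_j \to Q_i$ are onto, then each compatible homomorphism $\varphi_i: Q \to Q_i$ is onto.
   Context: A quandle is a non-empty set $Q$ with a binary operation $*$ such that $x*x=x$; for all $x,y$ there is a unique $z$ with $x=z*y$ (write $z=x*^{-1}y$); and $(x*y)*z=(x*z)*(y*z)$. A topological quandle is a quandle with a topology such that $*:Q\times Q\to Q$ is continuous and each right multiplication $R_q:p\mapsto p*q$ is a homeomorphism of $Q$. A directed set is a set $I$ with a reflexive and transitive relation $\le$ such that any two elements have an upper bound. A projective system $(Q_i,\varphi_{ij},I)$ of topological quandles consists of topological quandles $Q_i$ ($i\in I$) and continuous quandle homomorphisms $\varphi_{ij}:Q_j\to Q_i$ for $i\le j$ with $\varphi_{ii}=\mathrm{id}$ and $\varphi_{ij}\circ\varphi_{jk}=\varphi_{ik}$ for $i\le j\le k$. A family of (continuous) homomorphisms $\varphi_i:Q\to Q_i$ is compatible if $\varphi_{ij}\circ\varphi_j=\varphi_i$ for all $i\le j$. A projective limit is a quandle $Q$ with a compatible family $\varphi_i:Q\to Q_i$ such that for every quandle $R$ with a compatible family $r_i:R\to Q_i$ there is a unique homomorphism $\theta:R\to Q$ with $\varphi_i\circ\theta=r_i$ for all $i$. Concretely, if the set $Q=\{(q_i)\in\prod_{i\in I}Q_i : \varphi_{ij}(q_j)=q_i \text{ for all } i\le j\}$ is non-empty,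 it is a subquandle of the product, it is the projective limit (with the subspace topology from the product topology), and the maps $\varphi_i$ are the restrictions of the coordinate projections. Quandles are non-empty by definition, so existence of the projective limit means that this set is non-empty. *)

(* Defs.v *)
From HB Require Import structures.
From mathcomp Require Import all_boot all_classical topology.

Set Implicit Arguments.
Unset Strict Implicit.
Unset Printing Implicit Defensive.

Local Open Scope classical_set_scope.

HB.mixin Record isQuandle Q := {
  qop : Q -> Q -> Q;
  quandle_nonempty : inhabited Q;
  qopxx : forall x, qop x x = x;
  qop_rdiv : forall x y, exists! z, x = qop z y;
  qop_rdistr : forall x y z, qop (qop x y) z = qop (qop x z) (qop y z)
}.

#[short(type="quandleType")]
HB.structure Definition Quandle := { Q of isQuandle Q }.

Reserved Notation "x *q y" (at level 40, left associativity).
Notation "x *q y" := (qop x y).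

Definition homeomorphism (X Y : topologicalType) (f : X -> Y) :=
  continuous f /\
  exists g : Y -> X, [/\ continuous g, cancel f g & cancel g f].

HB.mixin Record Quandle_isTopological Q of Topological Q & isQuandle Q := {
  qop_continuous : continuous (fun xy : Q * Q => xy.1 *q xy.2);
  qop_homeomorphism : forall q : Q, homeomorphism (fun p : Q => p *q q)
}.

#[short(type="topologicalQuandleType")]
HB.structure Definition TopologicalQuandle :=
  { Q of Topological Q & isQuandle Q & Quandle_isTopological Q }.

(* [rdiv x y] is the unique z such that x = z *q y. *)
Definition rdiv (Q : quandleType) (x y : Q) : Q :=
  sval (cid (let: ex_intro z (conj zP _) := qop_rdiv x y in ex_intro _ z zP)).

Fact rdivK (Q : quandleType) (x y : Q) : rdiv x y *q y = x.
Proof. by rewrite /rdiv; case: cid => z. Qed.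

Fact qop_injr (Q : quandleType) (y : Q) : injective (fun x => x *q y).
Proof.
move=> a b /= ab; have [c [_ cu]] := qop_rdiv (a *q y) y.
by rewrite -(cu a)// (cu b).
Qed.

Fact rdiv_continuous (Q : topologicalQuandleType) (y : Q) :
  continuous (fun x : Q => rdiv x y).
Proof.
have [_ [g [gc _ gK]]] := qop_homeomorphism y.
rewrite (_ : (fun _ => _) = g)//; apply/funext => x.
by apply: (@qop_injr _ y); rewrite rdivK gK.
Qed.

Definition quandle_hom (Q R : quandleType) (f : Q -> R) :=
  forall x y, f (x *q y) = f x *q f y.

Definition directed (I : Type) (le : I -> I -> Prop) :=
  [/\ forall i, le i i,
      forall i j k, le i j -> le j k -> le i k
    & forall i j, exists k, le i k /\ le j k].

(* The laws hold for every proof of the order hypotheses, so a transition map *)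
(* depends only on its two indices.                                           *)
Record projSystem (I : Type) (le : I -> I -> Prop) := ProjSystem {
  pobj :> I -> topologicalQuandleType;
  transition : forall i j, le i j -> pobj j -> pobj i;
  transition_hom : forall i j (ij : le i j), quandle_hom (transition ij);
  transition_continuous : forall i j (ij : le i j), continuous (transition ij);
  transition_id : forall i (ii : le i i) x, transition ii x = x;
  transition_comp : forall i j k (ij : le i j) (jk : le j k) (ik : le i k) x,
    transition ij (transition jk x) = transition ik x
}.

Section ProjectiveLimit.
Context {I : Type} {le : I -> I -> Prop} (S : projSystem le).

Definition compatible (R : Type) (r : forall i, R -> S i) :=
  forall i j (ij : le i j) x, transition ij (r j x) = r i x.

Definition is_projective_limit (L : quandleType) (p : forall i, L -> S i) :=
  [/\ forall i, quandle_hom (p i),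
      compatible p
    & forall (R : quandleType) (r : forall i, R -> S i),
        (forall i, quandle_hom (r i)) -> compatible r ->
        exists! theta : R -> L,
          quandle_hom theta /\ forall i x, p i (theta x) = r i x].

Definition is_topological_projective_limit
    (L : topologicalQuandleType) (p : forall i, L -> S i) :=
  [/\ forall i, quandle_hom (p i) /\ continuous (p i),
      compatible p
    & forall (R : topologicalQuandleType) (r : forall i, R -> S i),
        (forall i, quandle_hom (r i) /\ continuous (r i)) -> compatible r ->
        exists! theta : R -> L,
          [/\ quandle_hom theta, continuous theta
            & forall i x, p i (theta x) = r i x]].

Definition threads : set (prod_topology (fun i => S i)) :=
  [set q | forall i j (ij : le i j), transition ij (q j) = q i].

(* Quandles are non-empty, so the limit exists only for a non-empty set of    *)
(* threads. [set_type] carries the subspace topology.                         *)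
Definition proj_lim of threads !=set0 : Type := set_type threads.

Section Instance.
Variable ne : threads !=set0.
Local Notation L := (proj_lim ne).

HB.instance Definition _ := Topological.copy L (set_type threads).

Definition proj_lim_map i (q : L) : S i := set_val q i.

Fact proj_lim_mapP (x : L) i j (ij : le i j) :
  transition ij (proj_lim_map j x) = proj_lim_map i x.
Proof. exact: (set_mem (valP x)). Qed.

Fact threads_qop (x y : L) :
  threads (fun i => proj_lim_map i x *q proj_lim_map i y).
Proof.
by move=> i j ij; rewrite transition_hom !proj_lim_mapP.
Qed.

Definition proj_lim_op (x y : L) : L :=
  exist _ (fun i => proj_lim_map i x *q proj_lim_map i y)
    (mem_set (threads_qop x y)).

Fact proj_lim_ext (x y : L) :
  (forall i, proj_lim_map i x = proj_lim_map i y) -> x = y.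
Proof. by move=> xy; apply/val_inj/functional_extensionality_dep. Qed.

Fact proj_lim_nonempty : inhabited L.
Proof. by case: ne => q tq; exists; exists q; exact: mem_set. Qed.

Fact proj_lim_opxx x : proj_lim_op x x = x.
Proof. by apply: proj_lim_ext => i; exact: qopxx. Qed.

Fact threads_rdiv (x y : L) :
  threads (fun i => rdiv (proj_lim_map i x) (proj_lim_map i y)).
Proof.
move=> i j ij; apply: (@qop_injr _ (proj_lim_map i y)) => /=.
by rewrite rdivK -(proj_lim_mapP y ij) -transition_hom rdivK proj_lim_mapP.
Qed.

Definition proj_lim_div (x y : L) : L :=
  exist _ (fun i => rdiv (proj_lim_map i x) (proj_lim_map i y))
    (mem_set (threads_rdiv x y)).

Fact proj_lim_rdiv x y : exists! z, x = proj_lim_op z y.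
Proof.
exists (proj_lim_div x y); split=> [|z ->]; apply: proj_lim_ext => i.
  by rewrite [RHS]rdivK.
by apply: (@qop_injr _ (proj_lim_map i y)); rewrite [LHS]rdivK.
Qed.

Fact proj_lim_rdistr x y z : proj_lim_op (proj_lim_op x y) z =
  proj_lim_op (proj_lim_op x z) (proj_lim_op y z).
Proof. by apply: proj_lim_ext => i; exact: qop_rdistr. Qed.

HB.instance Definition _ := isQuandle.Build L proj_lim_nonempty
  proj_lim_opxx proj_lim_rdiv proj_lim_rdistr.

Fact proj_lim_map_continuous i : continuous (@proj_lim_map i).
Proof.
pose P := prod_topology (fun i => S i).
have valc : continuous (set_val : L -> P) by exact: initial_continuous.
have coordc : continuous (fun f : P => f i).
  move=> f; have /cvg_sup/(_ i) fi : f --> (f : P) by exact: cvg_id.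
  exact: cvg_trans (cvg_app _ fi)
    (@initial_continuous _ _ (fun f : forall i, S i => f i) f).
by move=> x; exact: cvg_comp (valc x) (coordc _).
Qed.

Fact continuous_to_proj_lim (X : topologicalType) (f : X -> L) :
  (forall i, continuous (fun x => proj_lim_map i (f x))) -> continuous f.
Proof.
move=> fc; have := @continuous_comp_initial (set_type threads) X
  (prod_topology (fun i => S i)) set_val f.
apply=> x; apply/cvg_sup => i U /= [_ [[W oW <-]] Wx /filterS]; apply.
by apply: (fc i x); exact: open_nbhs_nbhs.
Qed.

Fact proj_lim_op_continuous :
  continuous (fun xy : L * L => xy.1 *q xy.2).
Proof.
apply: continuous_to_proj_lim => i [x y].
pose c := @proj_lim_map_continuous i.
have xyc : (fun uv : L * L => (proj_lim_map i uv.1, proj_lim_map i uv.2))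
    @ (x, y) --> (proj_lim_map i x, proj_lim_map i y).
  have fstc : (@fst L L) @ (x, y) --> x.
    exact: (@cvg_fst _ _ (nbhs x) (nbhs y)).
  have sndc : (@snd L L) @ (x, y) --> y.
    exact: (@cvg_snd _ _ (nbhs x) (nbhs y)).
  apply: cvg_pair; last exact: cvg_comp sndc (c y).
  exact: cvg_comp fstc (c x).
exact: cvg_comp xyc (@qop_continuous (S i) _).
Qed.

Fact proj_lim_op_homeomorphism (y : L) : homeomorphism (fun x : L => x *q y).
Proof.
split; last exists (fun x => proj_lim_div x y).
  apply: continuous_to_proj_lim => i x.
  have [c _] := qop_homeomorphism (proj_lim_map i y).
  exact: cvg_comp (@proj_lim_map_continuous i x) (c _).
split; last 2 first.
- move=> x; apply: proj_lim_ext => i.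
  by apply: (@qop_injr _ (proj_lim_map i y)); rewrite [LHS]rdivK.
- by move=> x; apply: proj_lim_ext => i; exact: rdivK.
apply: continuous_to_proj_lim => i x.
exact: cvg_comp (@proj_lim_map_continuous i x)
  (@rdiv_continuous _ (proj_lim_map i y) _).
Qed.

HB.instance Definition _ := Quandle_isTopological.Build L
  proj_lim_op_continuous proj_lim_op_homeomorphism.

End Instance.
End ProjectiveLimit.

Arguments threads {I le} S _.
Arguments proj_lim_map {I le S} ne i q.

(* Main.v *)
Require Import Defs.
From HB Require Import structures.
From mathcomp Require Import all_boot all_classical topology.

Set Implicit Arguments.
Unset Strict Implicit.
Unset Printing Implicit Defensive.

Local Open Scope classical_set_scope.

(** The only difficulty is to produce threads; given one, the limit inherits
    its universal properties from the product, because a compatible family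
    from [R] is the same thing as a map from [R] into the set of threads.

    Threads come from compactness of the product of the [S i].  For each
    index [k], the points of the product whose coordinates below [k] are the
    images of the coordinate at [k] form a closed set, non-empty since one may
    choose the coordinate at [k] freely and then push it down.  These sets
    decrease as [k] grows, so by directedness they form a filter base, and by
    compactness some point lies in the closure of all of them, hence in all of
    them: it is a thread.

    The same argument works when the coordinate at [k] is restricted to a
    non-empty closed subset [E k] of [S k], as long as the transition maps send
    each [E k] into the lower [E j]: this is [threads_in_closed].  Taking
    [E k] to be everything gives existence of the limit.  For surjectivity of
    the projection to [S i], let [E k] be the fibre over [x] of the transition
    from [S k] to [S i] when [i] is below [k], and all of [S k] otherwise; a
    thread in this family passes through [x].  Surjectivity of the transition
    maps is what makes these fibres non-empty. *)

Lemma closed_equalizer (X Y : topologicalType) (f g : X -> Y) :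
  hausdorff_space Y -> continuous f -> continuous g ->
  closed [set x | f x = g x].
Proof.
move=> hY cf cg x clx; apply: hY => A B nA nB.
have nAB : nbhs x (f @^-1` A `&` g @^-1` B).
  by apply: filterI; [exact: cf|exact: cg].
have [y [/= fgy [Ay By]]] := clx _ nAB.
by exists (f y); split=> //; rewrite fgy.
Qed.

(** Tychonoff's theorem indexed by a bare type, whose equality is made
    decidable classically. *)
Lemma compact_prod_topology (I : Type) (T : I -> topologicalType) :
  (forall i, compact [set: T i]) -> compact [set: prod_topology T].
Proof.
move=> cT; rewrite (_ : [set: _] =
    [set f : prod_topology T | forall i, [set: T i] (f i)]).
  exact: (@tychonoff {classic I} T (fun i => [set: T i]) cT).
by apply/seteqP; split.
Qed.

Lemma coord_continuous (I : Type) (T : I -> topologicalType) (i : I) :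
  continuous (fun f : prod_topology T => f i).
Proof. exact: (@proj_continuous {classic I} T i). Qed.

Section Threads.
Context {I : Type} {le : I -> I -> Prop} (S : projSystem le).

Lemma quandle_point (Q : quandleType) : exists x : Q, True.
Proof. by have [x] := @quandle_nonempty Q; exists x. Qed.

(** The indices below [k] get the images of [y]; the others, which [k] does not
    control, get an arbitrary point. *)
Lemma partial_thread_exists k (kk : le k k) (y : S k) :
  exists q : prod_topology (fun i => S i),
    q k = y /\ forall j (jk : le j k), transition jk (q k) = q j.
Proof.
have coord j : exists z : S j, forall jk : le j k, z = transition jk y.
  have [jk|njk] := pselect (le j k).
    by exists (transition jk y) => jk'; congr transition; exact: Prop_irrelevance.
  by have [x _] := quandle_point (S j); exists x.
pose q j := sval (cid (coord j)).
have qP j (jk : le j k) : q j = transition jk y := svalP (cid (coord j)) jk.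
have qk : q k = y by rewrite (qP _ kk) transition_id.
by exists q; split=> // j jk; rewrite qk qP.
Qed.

(** Compactness of the product turns the finite consistency of
    [partial_thread_exists] into full consistency.  The Hausdorff property is
    what makes each consistency condition closed, and the stability of [E]
    under the transitions is what makes the sets [B k] decrease with [k]. *)
Lemma threads_in_closed (E : forall k, set (S k)) :
  directed le ->
  (forall i, compact [set: S i]) -> (forall i, hausdorff_space (S i)) ->
  (forall k, closed (E k)) -> (forall k, E k !=set0) ->
  (forall j k (jk : le j k) y, E k y -> E j (transition jk y)) ->
  exists q, threads S q /\ forall k, E k (q k).
Proof.
move=> [refl_le trans_le ub_le] cS hS cE neE trE.
(* When there is no index the family of sets B below is empty, so it is not a
   filter base; every point of the product is then a thread. *)
have [[i0]|noI] := pselect (inhabited I); last first.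
  by exists (fun i => sval (cid (quandle_point (S i)))); split=> i; case: noI.
pose P := prod_topology (fun i => S i).
pose B k := [set q : P | E k (q k) /\
  forall j (jk : le j k), transition jk (q k) = q j].
have B_decr k l : le k l -> B l `<=` B k.
  move=> kl q [Eq qP]; split=> [|j jk]; first by rewrite -(qP _ kl); exact: trE.
  by rewrite -(qP _ kl) (transition_comp jk kl (trans_le _ _ _ jk kl)) qP.
have ne_B k : B k !=set0.
  have [y Ey] := neE k; have [q [qk qP]] := partial_thread_exists (refl_le k) y.
  by exists q; split=> //; rewrite qk.
have closed_B k : closed (B k).
  rewrite (_ : B k = [set q : P | E k (q k)] `&` \bigcap_(j in [set: I])
      \bigcap_(jk in [set: le j k]) [set q : P | transition jk (q k) = q j]).
    apply: closedI.
      apply: (preimage_closed (f := fun q : P => q k)) (cE k).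
      by move=> q _; exact: coord_continuous.
    apply: closed_bigI => j _; apply: closed_bigI => jk _.
    apply: (closed_equalizer (hS j)); last exact: coord_continuous.
    move=> q; apply: (@continuous_comp _ _ _ (fun q : P => q k)).
      exact: coord_continuous.
    exact: transition_continuous.
  apply/seteqP; split=> q [Eq qP]; split=> // j; first by move=> _ jk _; exact: qP.
  by move=> jk; exact: qP.
pose F := filter_from [set: I] B.
have FF : ProperFilter F.
  apply: filter_from_proper => //; apply: filter_from_filter; first by exists i0.
  move=> i j _ _; have [k [ik jk]] := ub_le i j.
  by exists k => // q Bq; split; exact: B_decr Bq.
have [q [_ qF]] := compact_prod_topology cS FF filterT.
have qB k : B k q.
  by apply: closed_B; move: qF; rewrite clusterE; apply; exists k.
by exists q; split=> [i j ij|k]; [exact: (qB j).2|exact: (qB k).1].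
Qed.

Lemma threads_nonempty :
  directed le ->
  (forall i, compact [set: S i]) -> (forall i, hausdorff_space (S i)) ->
  threads S !=set0.
Proof.
move=> dirI cS hS.
have [] := @threads_in_closed (fun _ => setT) dirI cS hS => //.
- by move=> k; have [x _] := quandle_point (S k); exists x.
- by move=> q [tq _]; exists q.
Qed.

Lemma thread_through i (x : S i) :
  directed le ->
  (forall i, compact [set: S i]) -> (forall i, hausdorff_space (S i)) ->
  (forall i j (ij : le i j), set_surj [set: S j] [set: S i] (transition ij)) ->
  exists q, threads S q /\ q i = x.
Proof.
move=> dirI cS hS surjS; have [refl_le trans_le _] := dirI.
(* Quantifying over the proofs of [le i k] makes [E k] the fibre over x when i
   is below k, and everything otherwise, without a case distinction. *)
pose E k := [set y : S k | forall ik : le i k, transition ik y = x].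
have [|||q [tq Eq]] := @threads_in_closed E dirI cS hS.
- move=> k; rewrite (_ : E k = \bigcap_(ik in [set: le i k])
      [set y : S k | transition ik y = x]).
    apply: closed_bigI => ik _; apply: (closed_equalizer (hS i)).
      exact: transition_continuous.
    by move=> y; exact: cvg_cst.
  by apply/seteqP; split=> y Ey ik => [_|]; exact: Ey.
- move=> k; have [ik|nik] := pselect (le i k).
    have [y _ yx] := surjS i k ik x Logic.I.
    by exists y => ik'; rewrite -yx; congr transition; exact: Prop_irrelevance.
  by have [y _] := quandle_point (S k); exists y.
- by move=> j k jk y Ey ij; rewrite (transition_comp ij jk (trans_le _ _ _ ij jk)).
exists q; split=> //.
by rewrite -(Eq i (refl_le i)) transition_id.
Qed.

Variable ne : threads S !=set0.

Lemma compatible_threads (R : Type) (r : forall i, R -> S i) (x : R) :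
  compatible r -> threads S (fun i => r i x).
Proof. by move=> rP i j ij; exact: rP. Qed.

Definition lift_to_proj_lim (R : Type) (r : forall i, R -> S i)
    (rP : compatible r) (x : R) : proj_lim ne :=
  exist _ (fun i => r i x) (mem_set (compatible_threads x rP)).

Lemma proj_lim_map_hom i : quandle_hom (proj_lim_map ne i).
Proof. by []. Qed.

Lemma proj_lim_map_compatible : compatible (proj_lim_map ne).
Proof. by move=> i j ij x; exact: proj_lim_mapP. Qed.

Lemma lift_to_proj_lim_hom (R : quandleType) (r : forall i, R -> S i)
    (rP : compatible r) :
  (forall i, quandle_hom (r i)) -> quandle_hom (lift_to_proj_lim rP).
Proof. by move=> hr x y; apply: proj_lim_ext => i; exact: hr. Qed.

Lemma lift_to_proj_lim_unique (R : Type) (r : forall i, R -> S i)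
    (rP : compatible r) (theta : R -> proj_lim ne) :
  (forall i x, proj_lim_map ne i (theta x) = r i x) ->
  lift_to_proj_lim rP = theta.
Proof. by move=> h; apply/funext => x; apply: proj_lim_ext => i; rewrite h. Qed.

Lemma proj_lim_is_limit : is_projective_limit (proj_lim_map ne).
Proof.
split; [exact: proj_lim_map_hom|exact: proj_lim_map_compatible|].
move=> R r hr rP; exists (lift_to_proj_lim rP); split.
  by split=> //; exact: lift_to_proj_lim_hom.
by move=> theta [_]; exact: lift_to_proj_lim_unique.
Qed.

Lemma proj_lim_is_topological_limit :
  is_topological_projective_limit (proj_lim_map ne).
Proof.
split; [|exact: proj_lim_map_compatible|].
  by move=> i; split; [exact: proj_lim_map_hom|exact: proj_lim_map_continuous].
move=> R r hr rP; exists (lift_to_proj_lim rP); split.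
  split=> //; first by apply: lift_to_proj_lim_hom => i; have [] := hr i.
  by apply: continuous_to_proj_lim => i; have [] := hr i.
by move=> theta [_ _]; exact: lift_to_proj_lim_unique.
Qed.

End Threads.

Theorem theorem4p4 (I : Type) (le : I -> I -> Prop) (dirI : directed le)
    (S : projSystem le)
    (compactS : forall i, compact [set: S i])
    (hausdorffS : forall i, hausdorff_space (S i)) :
  exists ne : threads S !=set0,
    [/\ is_projective_limit (proj_lim_map ne),
        is_topological_projective_limit (proj_lim_map ne)
      & (forall i j (ij : le i j),
           set_surj [set: S j] [set: S i] (transition ij)) ->
        forall i, set_surj [set: proj_lim ne] [set: S i] (proj_lim_map ne i)].
Proof.
exists (threads_nonempty dirI compactS hausdorffS); split.
- exact: proj_lim_is_limit.
- exact: proj_lim_is_topological_limit.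
- move=> surjS i x _.
  have [q [tq qx]] := thread_through x dirI compactS hausdorffS surjS.
  by exists (exist _ q (mem_set tq)).
Qed.
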